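(* Let $G$ be a simple connected undirected graph of order $n$ that is $r$-regular and $k$-resistance regular. Then the lexicographic product $G[K_2]$ satisfies $$E_R(G[K_2])=\rho_1(G)+\frac{2n}{r+1},$$ where $\rho_1(G)$ is the largest eigenvalue of the resistance distance matrix of $G$.
   Context: For a connected graph $G$ with vertices $v_1,\dots,v_n$, Laplacian matrix $L$ (degree matrix minus adjacency matrix) and Moore-Penrose inverse $L^\dagger=(l^\dagger_{ij})$, the resistance distance is $r_{ij}=l^\dagger_{ii}+l^\dagger_{jj}-2l^\dagger_{ij}$, and the resistance distance matrix is $R(G)=(r_{ij})$. $G$ is $k$-resistance regular if every row sum of $R(G)$ equals $k$; it is $r$-regular if every vertex has degree $r$. The resistance energy $E_R(G)$ is the sum of the absolute values of the eigenvalues of $R(G)$, counted with multiplicity. The lexicographic product $G_1[G_2]$ has vertex set $V(G_1)\times V(G_2)$, with $(v_1,u_1)$ and $(v_2,u_2)$ adjacent if $v_1v_2\in E(G_1)$, or $v_1=v_2$ and $u_1u_2\in E(G_2)$. $K_2$ is the complete graph on 2 vertices. *)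

(* Defs.v *)
From mathcomp Require Import all_boot all_order all_algebra.
From mathcomp Require Import polyrcf complex spectral.

Set Implicit Arguments.
Unset Strict Implicit.
Unset Printing Implicit Defensive.

Import Order.TTheory GRing.Theory Num.Theory.
Local Open Scope ring_scope.

Record sgraph := SGraph {
  vertex :> finType;
  adj : rel vertex;
  adj_sym : symmetric adj;
  adj_irrefl : irreflexive adj }.

Definition degree (G : sgraph) (x : G) : nat := #|[set y | adj x y]|.

Definition regular (G : sgraph) (r : nat) : Prop := forall x : G, degree x = r.

(* The empty graph does not count as connected. *)
Definition connected_graph (G : sgraph) : Prop :=
  (0 < #|G|)%N /\ forall x y : G, connect (@adj G) x y.

Section CompleteGraph.
Variable n : nat.
Definition complete_adj : rel 'I_n := fun i j => i != j.
Lemma complete_adj_sym : symmetric complete_adj.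
Proof. by move=> i j; rewrite /complete_adj eq_sym. Qed.
Lemma complete_adj_irrefl : irreflexive complete_adj.
Proof. by move=> i; rewrite /complete_adj eqxx. Qed.
Definition complete_graph := SGraph complete_adj_sym complete_adj_irrefl.
End CompleteGraph.

Section Lexicographic.
Variables G1 G2 : sgraph.
Definition lex_adj : rel (G1 * G2)%type := fun p q =>
  adj p.1 q.1 || (p.1 == q.1) && adj p.2 q.2.
Lemma lex_adj_sym : symmetric lex_adj.
Proof. by move=> p q; rewrite /lex_adj adj_sym eq_sym (adj_sym p.2). Qed.
Lemma lex_adj_irrefl : irreflexive lex_adj.
Proof. by move=> p; rewrite /lex_adj !adj_irrefl andbF. Qed.
Definition lex_product := SGraph lex_adj_sym lex_adj_irrefl.
End Lexicographic.

Section PenroseInverse.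
Variable R : realFieldType.

Definition penrose m n (A : 'M[R]_(m, n)) : pred 'M[R]_(n, m) := fun X =>
  [&& A *m X *m A == A, X *m A *m X == X,
      (A *m X)^T == A *m X & (X *m A)^T == X *m A].

Lemma gram_unit m n (B : 'M[R]_(m, n)) : row_free B -> B *m B^T \in unitmx.
Proof.
move=> Bfree; rewrite -row_free_unit; apply: inj_row_free => v vBB0.
apply: (row_free_inj Bfree); rewrite mul0mx.
have /matrixP/(_ 0 0) : (v *m B) *m (v *m B)^T = 0.
  by rewrite trmx_mul mulmxA -(mulmxA v) vBB0 mul0mx.
rewrite !mxE => /eqP; rewrite psumr_eq0; last first.
  by move=> j _; rewrite [_^T _ _]mxE -expr2 sqr_ge0.
move=> /allP w0; apply/rowP => j; rewrite [RHS]mxE.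
have := w0 j (mem_index_enum _); rewrite /= [_^T _ _]mxE -expr2 sqrf_eq0.
by move/eqP.
Qed.

Lemma penrose_exists m n (A : 'M[R]_(m, n)) : exists X, penrose A X.
Proof.
have defA := mulmx_base A.
have Bu := gram_unit (row_base_free A).
have Cu : (col_base A)^T *m col_base A \in unitmx.
  rewrite -[X in _ *m X]trmxK; apply: gram_unit.
  by rewrite /row_free mxrank_tr; exact: col_base_full.
move: (col_base A) (row_base A) defA Bu Cu; move: (\rank A) => k C B defA Bu Cu.
pose gB := invmx (B *m B^T); pose gC := invmx (C^T *m C).
have gBT : gB^T = gB by rewrite trmx_inv trmx_mul trmxK.
have gCT : gC^T = gC by rewrite trmx_inv trmx_mul trmxK.
exists (B^T *m gB *m gC *m C^T).
have AX : A *m (B^T *m gB *m gC *m C^T) = C *m gC *m C^T.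
  rewrite -defA -!mulmxA; congr (C *m _).
  by rewrite (mulmxA B) (mulmxA (B *m B^T)) mulmxV // mul1mx.
have XA : B^T *m gB *m gC *m C^T *m A = B^T *m gB *m B.
  rewrite -defA -!mulmxA; do 2!congr (_ *m _).
  by rewrite (mulmxA C^T) (mulmxA gC) mulVmx // mul1mx.
apply/and4P; split; rewrite ?AX ?XA; apply/eqP.
- by rewrite -defA -!mulmxA (mulmxA C^T) (mulmxA gC) mulVmx // mul1mx.
- by rewrite -!mulmxA (mulmxA B) (mulmxA (B *m B^T)) mulmxV // mul1mx.
- by rewrite !trmx_mul trmxK gCT mulmxA.
- by rewrite !trmx_mul trmxK gBT mulmxA.
Qed.

Definition mpinv m n (A : 'M[R]_(m, n)) : 'M[R]_(n, m) :=
  xchoose (penrose_exists A).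

Lemma mpinvP m n (A : 'M[R]_(m, n)) : penrose A (mpinv A).
Proof. exact: xchooseP. Qed.

Lemma penrose_unique m n (A : 'M[R]_(m, n)) X Y :
  penrose A X -> penrose A Y -> X = Y.
Proof.
move=> /and4P[/eqP AXA /eqP XAX /eqP AXt /eqP XAt].
move=> /and4P[/eqP AYA /eqP YAY /eqP AYt /eqP YAt].
have AXY : A *m X = A *m Y.
  by rewrite -AXt -{1}AYA -mulmxA trmx_mul AXt AYt mulmxA AXA.
have XYA : X *m A = Y *m A.
  by rewrite -XAt -{1}AYA -mulmxA mulmxA trmx_mul XAt YAt -mulmxA (mulmxA A) AXA.
by rewrite -XAX XYA -mulmxA AXY mulmxA.
Qed.

Lemma mpinv_eq m n (A : 'M[R]_(m, n)) X : penrose A X -> mpinv A = X.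
Proof. exact/penrose_unique/mpinvP. Qed.

End PenroseInverse.

Section Resistance.
Variables (R : realFieldType) (G : sgraph).

Definition adjacency_matrix : 'M[R]_#|G| :=
  \matrix_(i, j) (adj (enum_val i) (enum_val j))%:R.

Definition degree_matrix : 'M[R]_#|G| :=
  diag_mx (\row_i (degree (enum_val i))%:R).

Definition laplacian : 'M[R]_#|G| := degree_matrix - adjacency_matrix.

Definition resistance_matrix : 'M[R]_#|G| :=
  \matrix_(i, j) (mpinv laplacian i i + mpinv laplacian j j
                  - mpinv laplacian i j *+ 2).

Definition resistance_regular (k : R) : Prop :=
  forall i, \sum_j resistance_matrix i j = k.

End Resistance.

Section Spectrum.
Variable R : rcfType.

(* Only the eigenvalues lying in R are listed, each repeated according to its
   multiplicity in the characteristic polynomial; by char_poly_sym_eigenvalues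
   these are all the eigenvalues when A is symmetric. *)
Definition eigenvalues n (A : 'M[R]_n) : seq R :=
  flatten [seq nseq (mup x (char_poly A)) x | x <- rootsR (char_poly A)].

(* The default value for the empty list only matters for matrices that have no
   eigenvalue in R. *)
Definition largest_eigenvalue n (A : 'M[R]_n) : R :=
  \big[Num.max/head 0 (eigenvalues A)]_(x <- eigenvalues A) x.

Lemma char_poly_neq0 n (A : 'M[R]_n) : char_poly A != 0.
Proof. exact/monic_neq0/char_poly_monic. Qed.

Lemma mem_rootsR_char_poly n (A : 'M[R]_n) x :
  (x \in rootsR (char_poly A)) = root (char_poly A) x.
Proof.
by have := roots_on_rootsR (char_poly_neq0 A) x; rewrite in_itv.
Qed.

Lemma count_mem_eigenvalues n (A : 'M[R]_n) x :
  count_mem x (eigenvalues A) = mup x (char_poly A).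
Proof.
rewrite /eigenvalues count_flatten -map_comp sumnE big_map.
under eq_bigr => y _ do rewrite /= count_nseq /=.
have [xr|xNr] := boolP (x \in rootsR (char_poly A)).
  rewrite (bigD1_seq x) ?(sorted_uniq lt_trans ltxx (sorted_roots _ _ _)) //= eqxx mul1n big1 ?addn0 // => y /negPf->.
  by rewrite mul0n.
rewrite big_seq big1 => [|y yr].
  by rewrite mupNroot // -mem_rootsR_char_poly.
by case: eqVneq yr xNr => [-> ->|] //; rewrite mul0n.
Qed.

Lemma mem_eigenvalues n (A : 'M[R]_n) x :
  (x \in eigenvalues A) = eigenvalue A x.
Proof.
rewrite -has_pred1 has_count count_mem_eigenvalues -XsubC_dvd ?char_poly_neq0 //.
by rewrite dvdp_XsubCl eigenvalue_root_char.
Qed.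

Lemma eigenvaluesP n (A : 'M[R]_n) s :
  char_poly A = \prod_(x <- s) ('X - x%:P) -> perm_eq s (eigenvalues A).
Proof.
move=> As; apply/allP => x _ /=.
by rewrite count_mem_eigenvalues As mu_prod_XsubC.
Qed.

Lemma char_poly_sym_eigenvalues n (A : 'M[R]_n) :
  A^T = A -> char_poly A = \prod_(x <- eigenvalues A) ('X - x%:P).
Proof.
move=> Asym; suff [s As] : exists s, char_poly A = \prod_(x <- s) ('X - x%:P).
  by rewrite {1}As; apply/perm_big/eigenvaluesP.
pose Ac := map_mx (real_complex R) A.
have Aherm : Ac \is hermsymmx.
  apply: realsym_hermsym; first by apply/is_hermitianmxP; rewrite expr0 scale1r map_mx_id // /Ac; apply/matrixP=> i j; rewrite !mxE -{1}Asym mxE.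
  by apply/mxOverP => i j; rewrite mxE complex_real.
have := hermitian_normalmx Aherm => /orthomx_spectralP.
have := hermitian_spectral_diag_real Aherm.
set P := spectralmx Ac; set d := spectral_diag Ac => dreal AcE.
have Pu : P \in unitmx by apply: unitarymx_unit; apply: spectral_unitarymx.
exists [seq complex.Re (d 0 i) | i <- enum 'I_n].
apply: (@map_poly_inj _ _ (real_complex R)).
rewrite map_char_poly rmorph_prod big_map big_enum /= -/Ac.
have -> : char_poly Ac = char_poly (diag_mx d).
  have PAc : P *m Ac = diag_mx d *m P by rewrite {1}AcE !mulmxA mulmxV // mul1mx.
  have Pdet : \det (map_mx polyC P) != 0.
    by rewrite det_map_mx polyC_eq0 -unitfE -unitmxE.
  apply: (mulfI Pdet); rewrite [RHS]mulrC /char_poly /char_poly_mx -!det_mulmx.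
  by rewrite mulmxBr mulmxBl -!map_mxM PAc scalar_mxC.
rewrite char_poly_trig; last exact: diag_mx_is_trig.
apply: eq_bigr => i _; rewrite rmorphB /= map_polyX map_polyC /= mxE eqxx mulr1n.
by rewrite RRe_real //; apply: (mxOverP dreal).
Qed.

Lemma le_largest_eigenvalue n (A : 'M[R]_n) x :
  eigenvalue A x -> x <= largest_eigenvalue A.
Proof.
by rewrite -mem_eigenvalues => xA; exact: (@le_bigmax_seq _ _ _ _ _ x xpredT id xA).
Qed.

Lemma largest_eigenvalue_eigenvalue n (A : 'M[R]_n) x :
  eigenvalue A x -> eigenvalue A (largest_eigenvalue A).
Proof.
rewrite -!mem_eigenvalues /largest_eigenvalue => xA.
rewrite big_seq; elim/big_rec: _ => [|y z yA zA].
  by case: (eigenvalues A) xA => //= y s _; rewrite mem_head.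
by rewrite /Num.max; case: ifP.
Qed.

End Spectrum.

Definition resistance_energy (R : rcfType) (G : sgraph) : R :=
  \sum_(x <- eigenvalues (resistance_matrix R G)) `|x|.

(* Main.v *)
Require Import Defs.
From mathcomp Require Import all_boot all_order all_algebra.
From mathcomp Require Import ring.

(** The proof rests on the fact that a [k]-resistance regular graph with at least
    one vertex has resistance energy [2 * k] and largest resistance eigenvalue [k]
    ([resistance_energy_regular]).  Indeed the all-ones vector is an eigenvector
    of the resistance matrix for [k].  On its orthogonal complement the quadratic
    form of the resistance matrix is [-2] times that of the Moore-Penrose inverse
    of the Laplacian, hence nonpositive ([resistance_nonpos]); so all the other
    eigenvalues are nonpositive.  As the diagonal is zero, the eigenvalues add up
    to zero, and the absolute values of the others add up to [k]
    ([energy_constant_row_sum]).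

    It remains to see that the product of [G] with a complete graph on [m]
    vertices, [0 < m], is resistance regular, and to compute its row sum.  Let [E] be the
    incidence matrix of the fibres over [G], and [Q] the orthogonal projection
    onto the vectors with zero sum along each fibre.  If [G] is [r]-regular with
    Laplacian [L], the product has Laplacian [E *m L *m E^T + (m * r.+1) *: Q]
    ([laplacian_lex_complete]), whose two summands live on complementary spaces,
    so that its Moore-Penrose inverse is explicit ([mpinv_inflation]).  Since row
    sums of a resistance matrix involve only the diagonal and the trace of that
    inverse ([resistance_row_sum]), the row sum for the product comes out as
    [k / m + 2 * n * (m - 1) / (m * r.+1)], where [n] is the order of [G]
    ([resistance_row_sum_lex_complete]).  Take [m = 2] and double. *)

Set Implicit Arguments.
Unset Strict Implicit.
Unset Printing Implicit Defensive.

Import Order.TTheory GRing.Theory Num.Theory.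
Local Open Scope ring_scope.

(** * Symmetric matrices with at most one positive eigenvalue *)

Lemma char_poly_similar (F : fieldType) (n : nat) (P A B : 'M[F]_n) :
  P \in unitmx -> A *m P = P *m B -> char_poly A = char_poly B.
Proof.
move=> Pu AP.
have Pdet : \det (map_mx polyC P) != 0.
  by rewrite det_map_mx polyC_eq0 -unitfE -unitmxE.
apply: (mulIf Pdet); rewrite [RHS]mulrC /char_poly /char_poly_mx -!det_mulmx.
by rewrite mulmxBl mulmxBr -!map_mxM AP scalar_mxC.
Qed.

Section ConstantRowSum.
Variable R : rcfType.

Lemma sum_eigenvalues (n : nat) (A : 'M[R]_n) :
  A^T = A -> \sum_(x <- eigenvalues A) x = \tr A.
Proof.
case: n A => [|n] A Asym; have As := char_poly_sym_eigenvalues Asym;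
  have := size_char_poly A; rewrite As size_prod_XsubC => -[sz].
  by rewrite /mxtrace big_ord0; case: (eigenvalues A) sz => // _; rewrite big_nil.
apply: oppr_inj; rewrite -char_poly_trace // As -coefPn_prod_XsubC ?sz //.
Qed.

(** If a symmetric matrix with constant row sum [k] defines a quadratic form that
    is nonpositive on the hyperplane orthogonal to the all-ones vector, then [k]
    is an eigenvalue, and all the other eigenvalues, counted with multiplicity,
    are nonpositive. *)
Lemma eigenvalues_constant_row_sum (n : nat) (A : 'M[R]_n.+1) (k : R) :
  A^T = A -> (forall i, \sum_j A i j = k) ->
  (forall x : 'rV[R]_n.+1, \sum_j x 0 j = 0 -> (x *m A *m x^T) 0 0 <= 0) ->
  exists2 s, perm_eq (k :: s) (eigenvalues A) & all (fun x => x <= 0) s.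
Proof.
move=> Asym rowA A_le0.
(* Replacing the first basis vector by the all-ones vector makes the matrix block
   triangular, with diagonal blocks [k] and [D]. *)
pose J : 'cV[R]_n := const_mx 1.
pose B : 'M[R]_(1 + n) := A.
pose P : 'M[R]_(1 + n) := block_mx 1%:M 0 J 1%:M.
pose D := drsubmx B - J *m ursubmx B.
pose T : 'M[R]_(1 + n) := block_mx k%:M (ursubmx B) 0 D.
have Pu : P \in unitmx by rewrite unitmxE det_lblock !det1 mulr1 unitr1.
have Jk (i : 'I_(1 + n)) : B i (lshift n 0) + \sum_j B i (rshift 1 j) = k.
  by rewrite -(rowA i) [RHS](@big_split_ord _ _ _ 1 n) /= big_ord1.
have BP : B *m P = P *m T.
  rewrite -{1}[B]submxK /P /T !mulmx_block.
  rewrite !mulmx1 !mulmx0 !mul1mx !mul0mx !addr0 !add0r /D.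
  rewrite [J *m _ + _]addrCA subrr addr0 mul_mx_scalar.
  have rowJ m (N : 'M[R]_(m, n)) i : (N *m J) i 0 = \sum_j N i j.
    by rewrite mxE; apply: eq_bigr => j _; rewrite mxE mulr1.
  congr block_mx; apply/colP => i; rewrite mxE rowJ !mxE.
    rewrite ord1 eqxx mulr1n -(Jk (lshift n 0)).
    by congr (_ + _); apply: eq_bigr => j _; rewrite !mxE.
  rewrite mulr1 -(Jk (rshift 1 i)).
  by congr (_ + _); apply: eq_bigr => j _; rewrite !mxE.
have charA : char_poly A = ('X - k%:P) * char_poly D.
  rewrite (char_poly_similar Pu BP) /char_poly /char_poly_mx.
  rewrite map_block_mx scalar_mx_block opp_block_mx add_block_mx.
  rewrite raddf0 oppr0 add0r addr0 det_ublock; congr (_ * _).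
  by rewrite det_mx11 !mxE eqxx !mulr1n.
have /perm_to_rem kA : k \in eigenvalues A.
  by rewrite mem_eigenvalues eigenvalue_root_char charA rootM root_XsubC eqxx.
exists (rem k (eigenvalues A)); first by rewrite perm_sym.
apply/allP => x xs.
have : root (char_poly D) x.
  suff -> : char_poly D = \prod_(y <- rem k (eigenvalues A)) ('X - y%:P).
    by rewrite root_prod_XsubC.
  apply: (mulfI (negbT (polyXsubC_eq0 k))).
  by rewrite -charA char_poly_sym_eigenvalues // (perm_big _ kA) big_cons.
rewrite -eigenvalue_root_char => /eigenvalueP[v vD v_neq0].
(* An eigenvector of [D] lifts to an eigenvector of [A] that is
   orthogonal to the all-ones vector. *)
pose w : 'rV[R]_(1 + n) := row_mx (- (v *m J)) v.
have wP : w *m P = row_mx 0 v.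
  by rewrite mul_row_block !mulmx1 mulmx0 addNr add0r.
have wB : w *m B = x *: w.
  apply: (can_inj (mulmxK Pu)); rewrite -scalemxAl -mulmxA BP mulmxA wP.
  by rewrite mul_row_block !mul0mx mulmx0 !add0r vD scale_row_mx scaler0.
have w_sum : \sum_j w 0 j = 0.
  rewrite (@big_split_ord _ _ _ 1 n) /= big_ord1 row_mxEl mxE [X in - X + _]mxE.
  apply/eqP; rewrite addrC subr_eq0; apply/eqP; apply: eq_bigr => j _.
  by rewrite row_mxEr mxE mulr1.
have := A_le0 w w_sum; rewrite [w *m A]wB -scalemxAl mxE.
have ww : 0 < (w *m w^T) 0 0.
  have -> : (w *m w^T) 0 0 = \sum_j w 0 j ^+ 2.
    by rewrite mxE; apply: eq_bigr => j _; rewrite [_^T _ _]mxE expr2.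
  rewrite lt0r sumr_ge0 ?andbT => [|j _]; last exact: sqr_ge0.
  apply: contra v_neq0; rewrite psumr_eq0 => [|j _]; last exact: sqr_ge0.
  move=> /allP w0; apply/eqP/rowP => j; rewrite mxE -(row_mxEr (- (v *m J)) v).
  have := w0 (rshift 1 j) (mem_index_enum _).
  by rewrite /= sqrf_eq0 => /eqP.
by rewrite pmulr_lle0.
Qed.

(** When the trace is zero, [k] is the opposite of the sum of the other, nonpositive,
    eigenvalues, hence also the sum of their absolute values. *)
Lemma energy_constant_row_sum (n : nat) (A : 'M[R]_n) (k : R) :
  (0 < n)%N -> A^T = A -> \tr A = 0 -> (forall i, \sum_j A i j = k) ->
  (forall x : 'rV[R]_n, \sum_j x 0 j = 0 -> (x *m A *m x^T) 0 0 <= 0) ->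
  \sum_(x <- eigenvalues A) `|x| = 2 * k /\ largest_eigenvalue A = k.
Proof.
case: n A => // n A _ Asym trA rowA A_le0.
have [s kA s_le0] := eigenvalues_constant_row_sum Asym rowA A_le0.
have k_sum : k = \sum_(x <- s) `|x|.
  have := sum_eigenvalues Asym; rewrite trA -(perm_big _ kA) big_cons /=.
  move/eqP; rewrite addr_eq0 => /eqP ->; rewrite -sumrN !big_seq.
  by apply: eq_bigr => x xs; rewrite ler0_norm // (allP s_le0).
have k_ge0 : 0 <= k by rewrite k_sum sumr_ge0.
split.
  by rewrite -(perm_big _ kA) big_cons /= -k_sum ger0_norm // mulr2n mulrDl mul1r.
have Ak : eigenvalue A k by rewrite -mem_eigenvalues -(perm_mem kA) mem_head.
apply/le_anti; rewrite le_largest_eigenvalue // andbT.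
have := largest_eigenvalue_eigenvalue Ak.
rewrite -mem_eigenvalues -(perm_mem kA) inE => /predU1P[->//|xs].
by rewrite (le_trans (allP s_le0 _ xs)).
Qed.
End ConstantRowSum.

(** * Moore-Penrose inverses of symmetric matrices *)

Section SymmetricPseudoinverse.
Variable R : realFieldType.

Lemma mpinv_sym (n : nat) (A : 'M[R]_n) : A^T = A -> (mpinv A)^T = mpinv A.
Proof.
move=> Asym; apply/esym/mpinv_eq.
have /and4P[/eqP AXA /eqP XAX /eqP AXt /eqP XAt] := mpinvP A.
apply/and4P; split; apply/eqP.
- by apply: trmx_inj; rewrite !trmx_mul !trmxK Asym mulmxA.
- by apply: trmx_inj; rewrite !trmx_mul !trmxK Asym mulmxA.
- by rewrite trmx_mul trmxK Asym -XAt trmx_mul Asym.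
- by rewrite trmx_mul trmxK Asym -AXt trmx_mul Asym.
Qed.

Lemma mpinv_sym_ker (n p : nat) (A : 'M[R]_n) (x : 'M[R]_(n, p)) :
  A^T = A -> A *m x = 0 -> mpinv A *m x = 0.
Proof.
move=> Asym Ax0; have /and4P[_ /eqP XAX /eqP AXt _] := mpinvP A.
by rewrite -XAX -(mulmxA (mpinv A)) -AXt trmx_mul Asym -!mulmxA Ax0 !mulmx0.
Qed.

Lemma mpinv_psd (n : nat) (A : 'M[R]_n) : A^T = A ->
  (forall x : 'rV[R]_n, 0 <= (x *m A *m x^T) 0 0) ->
  forall x : 'rV[R]_n, 0 <= (x *m mpinv A *m x^T) 0 0.
Proof.
move=> Asym A_ge0 x; have /and4P[_ /eqP XAX _ _] := mpinvP A.
have := A_ge0 (x *m mpinv A); rewrite trmx_mul mpinv_sym //.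
by rewrite -!mulmxA (mulmxA A) (mulmxA (mpinv A)) (mulmxA (mpinv A)) XAX.
Qed.

(** If the columns of [E] are orthogonal of squared norm [s], then [Q] is the
    orthogonal projection onto the complement of its column space.  Hence
    [E *m A *m E^T] and [d *: Q] act on complementary invariant spaces and can be
    pseudo-inverted separately. *)
Lemma mpinv_inflation (n p : nat) (s d : R) (E : 'M[R]_(p, n)) (A : 'M[R]_n) :
  s != 0 -> d != 0 -> E^T *m E = s%:M ->
  let Q := 1%:M - s^-1 *: (E *m E^T) in
  mpinv (E *m A *m E^T + d *: Q) =
  s^-2 *: (E *m mpinv A *m E^T) + d^-1 *: Q.
Proof.
move=> s0 d0 EE Q.
have QT : Q^T = Q by rewrite /Q linearB linearZ /= trmx1 trmx_mul trmxK.
have QE : Q *m E = 0.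
  rewrite /Q mulmxBl mul1mx -scalemxAl -mulmxA EE mul_mx_scalar scalerA.
  by rewrite mulVf // scale1r subrr.
have EQ : E^T *m Q = 0 by rewrite -QT -trmx_mul QE trmx0.
have QQ : Q *m Q = Q.
  by rewrite {1}/Q mulmxBl mul1mx -scalemxAl -mulmxA EQ mulmx0 scaler0 subr0.
have mulE (B C : 'M[R]_n) (b c : R) :
  (E *m B *m E^T + b *: Q) *m (E *m C *m E^T + c *: Q) =
  s *: (E *m (B *m C) *m E^T) + (b * c) *: Q.
  rewrite mulmxDl !mulmxDr -!scalemxAl -!scalemxAr QQ scalerA.
  rewrite -!mulmxA EQ !mulmxA QE !(mulmx0, mul0mx) !scaler0 add0r addr0.
  rewrite -!mulmxA (mulmxA E^T E) EE.
  by rewrite mul_scalar_mx -!scalemxAr !mulmxA.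
have /and4P[/eqP AXA /eqP XAX /eqP AXt /eqP XAt] := mpinvP A.
pose X := s^-2 *: mpinv A.
have -> : s^-2 *: (E *m mpinv A *m E^T) = E *m X *m E^T.
  by rewrite /X -scalemxAr -scalemxAl.
have sym (B : 'M[R]_n) : B^T = B -> 
    (s *: (E *m B *m E^T) + 1 *: Q)^T = s *: (E *m B *m E^T) + 1 *: Q.
  by move=> Bsym; rewrite scale1r linearD linearZ /= !trmx_mul trmxK Bsym QT mulmxA.
have scE (B : 'M[R]_n) : s *: (E *m B *m E^T) = E *m (s *: B) *m E^T.
  by rewrite -scalemxAr -scalemxAl.
apply: mpinv_eq; apply/and4P; split; apply/eqP; rewrite !mulE ?divff ?mulVf //.
- rewrite scE mulE mul1r /X -!(scalemxAr, scalemxAl) AXA !scalerA.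
  by rewrite -[in RHS](scale1r (E *m A *m E^T)); congr (_ *: _ + _); field.
- rewrite scE mulE mul1r /X -!(scalemxAr, scalemxAl) XAX !scalerA.
  by congr (_ *: _ + _); field.
- by apply: sym; rewrite /X -!scalemxAr linearZ /= AXt.
- by apply: sym; rewrite /X -!scalemxAl linearZ /= XAt.
Qed.

End SymmetricPseudoinverse.

(** * Laplacian and resistance matrices *)

Lemma sum_enum_val (V : nmodType) (T : finType) (F : T -> V) :
  \sum_x F x = \sum_(i < #|T|) F (enum_val i).
Proof.
rewrite (reindex_onto _ _ (in1W enum_rankK)) /=.
by apply: eq_bigl => i; rewrite enum_valK eqxx.
Qed.

Section GraphMatrices.
Variable R : realFieldType.
Implicit Type G : sgraph.

Lemma degree_sum G (x : G) : (degree x)%:R = \sum_y (adj x y)%:R :> R.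
Proof.
by rewrite -natr_sum /degree cardsE -sum1_card big_mkcond; congr _%:R.
Qed.

Lemma laplacianE G (i j : 'I_#|G|) : laplacian R G i j =
  (degree (enum_val i))%:R *+ (i == j) - (adj (enum_val i) (enum_val j))%:R.
Proof. by rewrite !mxE. Qed.

Lemma laplacian_sym G : (laplacian R G)^T = laplacian R G.
Proof.
apply/matrixP => i j; rewrite mxE !laplacianE adj_sym eq_sym.
by case: eqP => [->|].
Qed.

Lemma degree_sum_ord G (i : 'I_#|G|) : (degree (enum_val i))%:R =
  \sum_(j < #|G|) (adj (enum_val i) (enum_val j))%:R :> R.
Proof. by rewrite degree_sum sum_enum_val. Qed.

Lemma laplacian_row_sum G i : \sum_j laplacian R G i j = 0.
Proof.
under eq_bigr do rewrite laplacianE.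
rewrite sumrB -degree_sum_ord (bigD1 i) //= eqxx big1 ?addr0 ?subrr // => j.
by rewrite eq_sym => /negPf ->.
Qed.

(** The Laplacian quadratic form is half the sum of [(x i - x j) ^+ 2] over the
    ordered pairs of adjacent vertices. *)
Lemma laplacian_psd G (x : 'rV[R]_#|G|) :
  0 <= (x *m laplacian R G *m x^T) 0 0.
Proof.
pose a (i j : 'I_#|G|) : R := (adj (enum_val i) (enum_val j))%:R.
have aC i j : a i j = a j i by rewrite /a adj_sym.
rewrite -(pmulr_rge0 _ (ltr0n R 2)).
suff -> : 2 * (x *m laplacian R G *m x^T) 0 0 =
    \sum_i \sum_j a i j * (x 0 i - x 0 j) ^+ 2.
  by do 2!apply: sumr_ge0 => ? _; rewrite mulr_ge0 ?ler0n ?sqr_ge0.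
have -> : (x *m laplacian R G *m x^T) 0 0 =
    \sum_i \sum_j a i j * (x 0 i ^+ 2 - x 0 i * x 0 j).
  rewrite -mulmxA mxE; apply: eq_bigr => i _; rewrite mxE mulr_sumr.
  under eq_bigr do rewrite laplacianE [_^T _ _]mxE mulrBl mulrBr.
  rewrite sumrB (bigD1 i) //= eqxx mulr1n big1 ?addr0 => [|j]; last first.
    by rewrite eq_sym => /negPf ->; rewrite mul0r mulr0.
  under [RHS]eq_bigr do rewrite mulrBr.
  rewrite sumrB degree_sum_ord mulr_suml mulr_sumr.
  by congr (_ - _); apply: eq_bigr => j _; rewrite /a; ring.
rewrite mulr2n mulrDl mul1r {2}exchange_big -big_split; apply: eq_bigr => i _.
by rewrite -big_split; apply: eq_bigr => j _ /=; rewrite (aC j i); ring.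
Qed.

Lemma resistanceE G (i j : 'I_#|G|) : resistance_matrix R G i j =
  mpinv (laplacian R G) i i + mpinv (laplacian R G) j j
  - mpinv (laplacian R G) i j *+ 2.
Proof. by rewrite mxE. Qed.

Lemma mpinv_laplacian_row_sum G i : \sum_j mpinv (laplacian R G) i j = 0.
Proof.
have L1 : laplacian R G *m (const_mx 1 : 'cV_#|G|) = 0.
  apply/colP => j; rewrite !mxE -[RHS](laplacian_row_sum j).
  by apply: eq_bigr => l _; rewrite [const_mx _ _ _]mxE mulr1.
have /colP/(_ i) := mpinv_sym_ker (laplacian_sym G) L1.
rewrite [LHS]mxE [RHS]mxE => Le; rewrite -[RHS]Le.
by apply: eq_bigr => l _; rewrite [const_mx _ _ _]mxE mulr1.
Qed.

Lemma resistance_row_sum G i : \sum_j resistance_matrix R G i j =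
  #|G|%:R * mpinv (laplacian R G) i i + \tr (mpinv (laplacian R G)).
Proof.
under eq_bigr do rewrite resistanceE.
rewrite sumrB sumrMnl mpinv_laplacian_row_sum mul0rn subr0 big_split /=.
by rewrite sumr_const card_ord mulr_natl.
Qed.

Lemma resistance_sym G : (resistance_matrix R G)^T = resistance_matrix R G.
Proof.
apply/matrixP => i j; rewrite mxE !resistanceE.
rewrite -{3}(mpinv_sym (laplacian_sym G)) mxE.
by rewrite (addrC (mpinv _ i i)).
Qed.

Lemma resistance_trace G : \tr (resistance_matrix R G) = 0.
Proof. by apply: big1 => i _; rewrite resistanceE mulr2n subrr. Qed.

(** Up to rank-one terms that vanish on vectors of coordinate sum zero, the
    resistance matrix is [- 2 *: mpinv (laplacian R G)]. *)
Lemma resistance_nonpos G (x : 'rV[R]_#|G|) : \sum_j x 0 j = 0 ->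
  (x *m resistance_matrix R G *m x^T) 0 0 <= 0.
Proof.
move=> x0; pose M := mpinv (laplacian R G).
pose u : 'cV[R]_#|G| := \col_i M i i; pose e : 'cV[R]_#|G| := const_mx 1.
have -> : resistance_matrix R G = u *m e^T + e *m u^T - 2 *: M.
  by apply/matrixP => i j; rewrite resistanceE !mxE !big_ord1 !mxE
    mulr1 mul1r mulr_natl.
have xe : x *m e = 0.
  by apply/matrixP => i j; rewrite !mxE -[RHS]x0;
    apply: eq_bigr => l _; rewrite !mxE mulr1 ord1.
have ex : e^T *m x^T = 0 by rewrite -trmx_mul xe trmx0.
rewrite mulmxBr mulmxDr mulmxBl mulmxDl !mulmxA xe !mul0mx addr0.
rewrite -[x *m u *m e^T *m x^T]mulmxA ex mulmx0 add0r mxE oppr_le0.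
rewrite -scalemxAr -scalemxAl mxE mulr_ge0 ?ler0n //.
by apply: mpinv_psd; [exact: laplacian_sym | exact: laplacian_psd].
Qed.
End GraphMatrices.

(** * Lexicographic products with a complete graph *)

Section LexicographicComplete.
Variables (R : realFieldType) (G : sgraph) (m : nat).
Hypothesis m_gt0 : (0 < m)%N.
Let H := lex_product G (complete_graph m).

Lemma card_lex_complete : #|H| = (#|G| * m)%N.
Proof. by rewrite card_prod card_ord. Qed.

Lemma lex_complete_adjE (p q : H) :
  adj p q = (adj p.1 q.1 || (p.1 == q.1)) && (p != q).
Proof.
case: p q => [x u] [y v]; rewrite /= /lex_adj /= /complete_adj xpair_eqE.
by case: eqVneq => [->|_]; rewrite ?adj_irrefl // andbT orbF.
Qed.

(** The closed neighbourhood of [p] is the union of the fibres over the closed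
    neighbourhood of [p.1]. *)
Lemma degree_lex_complete (p : H) : (degree p).+1 = (m * (degree p.1).+1)%N.
Proof.
pose N := p.1 |: [set y | adj p.1 y].
have -> : (degree p).+1 = #|setX N [set: 'I_m]|.
  rewrite (cardsD1 p) !inE eqxx /=; congr _.+1; apply: eq_card => q.
  by rewrite !inE lex_complete_adjE andbT andbC orbC eq_sym (eq_sym q.1).
by rewrite cardsX cardsT card_ord mulnC cardsU1 inE adj_irrefl.
Qed.

(** The index of the vertex of [G] above which the [p]-th vertex of the product
    lies. *)
Definition fibre_index (p : 'I_#|H|) : 'I_#|G| := enum_rank (enum_val p).1.

(** Incidence matrix between the vertices of the product and the fibres of its
    projection to [G]; in product coordinates it is the Kronecker product of the
    identity with an all-ones column. *)
Definition fibre_mx : 'M[R]_(#|H|, #|G|) := rowsub fibre_index 1%:M.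

Lemma fibre_mx_conjE (A : 'M[R]_#|G|) (p q : 'I_#|H|) :
  (fibre_mx *m A *m fibre_mx^T) p q = A (fibre_index p) (fibre_index q).
Proof.
rewrite /fibre_mx mul_rowsub_mx mul1mx -[X in X *m _]trmxK -trmx_mul.
by rewrite mul_rowsub_mx mul1mx !mxE.
Qed.

Lemma fibre_mx_gramE (p q : 'I_#|H|) :
  (fibre_mx *m fibre_mx^T) p q = (fibre_index p == fibre_index q)%:R.
Proof. by rewrite -{1}[fibre_mx]mulmx1 fibre_mx_conjE mxE. Qed.

Lemma fibre_mx_gram : fibre_mx^T *m fibre_mx = m%:R%:M.
Proof.
apply/matrixP => i j; rewrite !mxE.
transitivity (\sum_(p : H) ((enum_rank p.1 == i) && (enum_rank p.1 == j))%:R : R).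
  rewrite (sum_enum_val (fun p : H =>
    ((enum_rank p.1 == i) && (enum_rank p.1 == j))%:R)).
  by apply: eq_bigr => p _; rewrite !mxE -natrM mulnb.
rewrite -(pair_bigA _ (fun x (_ : 'I_m) =>
  ((enum_rank x == i) && (enum_rank x == j))%:R)) /=.
under eq_bigr do rewrite sumr_const card_ord.
rewrite (bigD1 (enum_val i)) //= enum_valK eqxx big1 ?addr0 /=.
  by case: eqP; rewrite ?mul0rn.
move=> x /negPf xi; rewrite -(inj_eq enum_val_inj) enum_rankK xi mul0rn //.
Qed.

Lemma scaled_coprojection_entry (N : nat) (a b : R) (B : 'M[R]_N) (i j : 'I_N) :
  (a *: (1%:M - b *: B)) i j = a * ((i == j)%:R - b * B i j).
Proof. by rewrite !mxE. Qed.

(** On vectors constant along the fibres the Laplacian of the product is [m] times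
    that of [G]; on vectors with zero sum along each fibre it is the scalar
    [m * r.+1]. *)
Lemma laplacian_lex_complete (r : nat) : regular G r ->
  laplacian R H = fibre_mx *m laplacian R G *m fibre_mx^T
    + (m * r.+1)%:R *: (1%:M - m%:R^-1 *: (fibre_mx *m fibre_mx^T)).
Proof.
move=> Greg; apply/matrixP => p q.
have m0 : m%:R != 0 :> R by rewrite pnatr_eq0 -lt0n.
rewrite [RHS]mxE fibre_mx_conjE !laplacianE !enum_rankK Greg.
rewrite scaled_coprojection_entry fibre_mx_gramE.
have -> : (degree (enum_val p))%:R = (m * r.+1)%:R - 1 :> R.
  by rewrite -(Greg (enum_val p).1) -degree_lex_complete -natr1 addrK.
rewrite mulrBr mulrA natrM [_ * _ / _]mulrAC divff // mul1r.
rewrite lex_complete_adjE (inj_eq enum_rank_inj) (inj_eq enum_val_inj).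
have [->|] := eqVneq p q; first by rewrite !eqxx adj_irrefl /= !mulr1n -natr1; ring.
move=> _; rewrite andbT /= mulr0n.
have [->|] := eqVneq; first by rewrite adj_irrefl /= mulr1n -natr1; ring.
by move=> _; rewrite orbF /= mulr0n; ring.
Qed.

Lemma resistance_row_sum_lex_complete (r : nat) (k : R) : regular G r ->
  resistance_regular G k ->
  resistance_regular H (k / m%:R + 2 * #|G|%:R * (m%:R - 1) / (m * r.+1)%:R).
Proof.
move=> Greg Gk p.
have m0 : m%:R != 0 :> R by rewrite pnatr_eq0 -lt0n.
have r0 : r.+1%:R != 0 :> R by rewrite pnatr_eq0.
have d0 : (m * r.+1)%:R != 0 :> R by rewrite natrM mulf_neq0.
rewrite resistance_row_sum (laplacian_lex_complete Greg).
rewrite (mpinv_inflation _ m0 d0 fibre_mx_gram).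
rewrite -(Gk (fibre_index p)) resistance_row_sum.
set L := mpinv _.
have -> : \tr (m%:R ^- 2 *: (fibre_mx *m L *m fibre_mx^T) +
   (m * r.+1)%:R^-1 *: (1%:M - m%:R^-1 *: (fibre_mx *m fibre_mx^T))) =
   m%:R^-1 * \tr L + (m * r.+1)%:R^-1 * (#|G|%:R * m%:R - #|G|%:R).
  rewrite mxtraceD !mxtraceZ linearB /= mxtraceZ mxtrace1.
  rewrite mxtrace_mulC mulmxA (mxtrace_mulC fibre_mx) fibre_mx_gram.
  rewrite mul_scalar_mx mxtraceZ mxtrace_scalar card_lex_complete.
  rewrite !natrM -[_ *+ #|G|]mulr_natr.
  by field; rewrite nat1r r0 m0.
rewrite mxE [X in _ * (X + _)]mxE fibre_mx_conjE scaled_coprojection_entry.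
rewrite fibre_mx_gramE !eqxx card_lex_complete !natrM.
by rewrite mulr1n; field; rewrite nat1r r0 m0.
Qed.

End LexicographicComplete.

(** * Energies *)

Lemma resistance_energy_regular (R : rcfType) (G : sgraph) (k : R) :
  (0 < #|G|)%N -> resistance_regular G k ->
  resistance_energy R G = 2 * k /\
  largest_eigenvalue (resistance_matrix R G) = k.
Proof.
move=> G_gt0 Gk; apply: energy_constant_row_sum => //.
- exact: resistance_sym.
- exact: resistance_trace.
- exact: resistance_nonpos.
Qed.

Theorem corollary5p3 (R : rcfType) (G : sgraph) (n r : nat) (k : R)
    (hn : #|G| = n) (hconn : connected_graph G) (hr : regular G r)
    (hk : resistance_regular G k) :
  resistance_energy R (lex_product G (complete_graph 2)) =
  largest_eigenvalue (resistance_matrix R G) + (2 * n)%:R / (r + 1)%:R.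
Proof.
have G_gt0 : (0 < #|G|)%N by case: hconn.
have H_gt0 : (0 < #|lex_product G (complete_graph 2)|)%N.
  by rewrite card_lex_complete muln_gt0 G_gt0.
have Hk := resistance_row_sum_lex_complete (isT : 0 < 2)%N hr hk.
have [-> _] := resistance_energy_regular H_gt0 Hk.
have [_ ->] := resistance_energy_regular G_gt0 hk.
have r0 : r.+1%:R != 0 :> R by rewrite pnatr_eq0.
by rewrite hn addn1 !natrM; field; rewrite nat1r r0.
Qed.
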